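(* Let $Q$ be a countable better quasi-order. If $Q$ is thin, then the class $\mathcal{FT}_Q$ of finite $Q$-labeled trees, ordered by $\leqq_1$, is thin.
   Context: A quasi-order is a set (or class) $Q$ with a reflexive transitive relation $\leqq_Q$. $[\omega]^\omega$ is the set of infinite subsets of $\omega$, identified with strictly increasing sequences and topologized as a subspace of $\omega^\omega$; for infinite $A\subseteq\omega$, $[A]^\omega$ is the set of infinite subsets of $A$. A quasi-order $Q$ is a better quasi-order (BQO) if, giving $Q$ the discrete topology, for every Borel map $f:[\omega]^\omega\to Q$ there is $A\in[\omega]^\omega$ such that $f(B)\leqq_Q f(B\setminus\{\min B\})$ for all $B\in[A]^\omega$. A Borel graph is a pair $(V,E)$ with $V$ Polish and $E\subseteq[V]^2$ Borel. Its Borel chromatic number $\chi_B$ is the least cardinality $|Y|$ of a Polish space $Y$ for which there is a Borel map $V\to Y$ sending adjacent vertices to distinct points. For a countable BQO $Q$, let $\vec Q=\{X\in Q^\omega:\forall k\in\omega,\ X(k)\not\leqq_Q X(k+1)\}$ (subspace of $Q^\omega$ with the product of discrete topologies), regarded as a Borel graph in which distinct $X,Y$ are adjacent iff $S(X)=Y$ or $S(Y)=X$, where $S(X)(k)=X(k+1)$. A countable BQO $Q$ is thin if $\chi_B(\vec Q)\leq 3$. A BQO (set or class) that is not assumed countable is called thin if every countably infinite subset of it, with the induced order, is thin. A tree is a partial order $(T,\leq_T)$ such that for each $t\in T$ the set $\{v\in T:v\leq_T t\}$ is well ordered by $\leq_T$, and $T$ has a $\leq_T$-least element (the root). $\mathcal{FT}_Q$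 is the class of pairs $(T,l)$ with $T$ a finite tree and $l:T\to Q$. The order $\leqq_1$: $(T_1,l_1)\leqq_1(T_2,l_2)$ iff there is $f:T_1\to T_2$ such that for all $x,y\in T_1$, $x<_{T_1}y$ implies $f(x)<_{T_2}f(y)$, and $l_1(x)\leqq_Q l_2(f(x))$ for all $x\in T_1$. *)

(* Defs.v *)
From mathcomp Require Import all_boot all_order all_algebra.
From mathcomp Require Import all_classical all_reals all_analysis.

Set Implicit Arguments.
Unset Strict Implicit.
Unset Printing Implicit Defensive.

Local Open Scope classical_set_scope.
Local Open Scope card_scope.

(* Membership in the Borel sigma-algebra; measurableType is avoided because it
   excludes empty spaces, and [vec le] below may be empty. *)
Definition borel (X : topologicalType) (A : set X) : Prop := (<<s @open X >>) A.

Definition borel_map (X Y : topologicalType) (f : X -> Y) : Prop :=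
  forall U : set Y, open U -> borel (f @^-1` U).

(* The library's completeType is pointed; completeness is spelled out here so
   that the empty space is Polish. *)
Definition cauchy_complete (M : uniformType) : Prop :=
  forall F : set_system M, ProperFilter F -> cauchy F -> exists x : M, F --> x.

Definition separable (X : topologicalType) : Prop :=
  exists2 D : set X, countable D & dense D.

Definition homeomorphic (X Y : topologicalType) : Prop :=
  exists (f : X -> Y) (g : Y -> X),
    [/\ cancel f g, cancel g f, continuous f & continuous g].

Definition polish (R : realType) (X : topologicalType) : Prop :=
  separable X /\ exists2 M : metricType R, cauchy_complete M & homeomorphic X M.

Definition borel_coloring (V Y : topologicalType) (E : V -> V -> Prop)
    (c : V -> Y) : Prop :=
  borel_map c /\ forall x y, E x y -> c x <> c y.

(* The Borel chromatic number of (V, E), i.e. the least |Y| over the Polish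
   spaces Y receiving a Borel coloring, is at most n. *)
Definition borel_chromatic_number_le (R : realType) (V : topologicalType)
    (E : V -> V -> Prop) (n : nat) : Prop :=
  exists Y : topologicalType,
    [/\ polish R Y, [set: Y] #<= `I_n & exists c : V -> Y, borel_coloring E c].

Notation discrete T := (discrete_topology {classic T}).

(* T^omega with the product of the discrete topologies *)
Notation seqspace T := (prod_topology (fun _ : nat => discrete T)).

Definition shift_seq (T : Type) (X : nat -> T) : nat -> T := fun k => X k.+1.

Definition strictly_increasing (s : nat -> nat) : Prop :=
  forall i j : nat, (i < j)%N -> (s i < s j)%N.

(* [omega]^omega: an infinite subset of nat is represented by its strictly
   increasing enumeration B, the subset itself being [range (val B)]; set_type
   carries the subspace topology. *)
Definition incseq : topologicalType :=
  set_type [set s : prod_topology (fun _ : nat => nat) | strictly_increasing s].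

Lemma strictly_increasing_shift (B : incseq) :
  shift_seq (val B) \in
    [set s : prod_topology (fun _ : nat => nat) | strictly_increasing s].
Proof.
case: B => s /= /set_mem incs; apply/mem_set => i j ij.
by apply: incs; rewrite ltnS.
Qed.

Definition remove_min (B : incseq) : incseq :=
  exist _ (shift_seq (val B)) (strictly_increasing_shift B).

(* Under the representation above, remove_min B is B minus its minimum. *)
Lemma range_remove_min (B : incseq) :
  (forall i, val B 0 <= val B i)%N /\
  range (val (remove_min B)) = range (val B) `\ val B 0.
Proof.
case: B => s /= incs; have /set_mem {}incs := incs; split.
  by case=> // i; apply/ltnW/incs.
apply/seteqP; split=> [_ [i _ <-]|_ [[[|i] _ <-] ne]].
- split; first by exists i.+1.
  by move=> /= e; have := incs 0 i.+1 isT; rewrite -e /shift_seq ltnn.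
- by case: ne.
- by exists i.
Qed.

(* B in [A]^omega *)
Definition subseq_of (A B : incseq) : Prop := range (val B) `<=` range (val A).

Definition quasi_order (T : Type) (le : T -> T -> Prop) : Prop :=
  (forall x, le x x) /\ (forall y x z, le x y -> le y z -> le x z).

Definition bqo (T : Type) (le : T -> T -> Prop) : Prop :=
  quasi_order le /\
  forall f : incseq -> discrete T, borel_map f ->
    exists A : incseq, forall B : incseq, subseq_of A B ->
      le (f B) (f (remove_min B)).

Section Vec.
Context (T : Type) (le : T -> T -> Prop).

Definition vec : topologicalType :=
  set_type [set X : seqspace T | forall k : nat, ~ le (X k) (X k.+1)].

Definition vec_adj (X Y : vec) : Prop :=
  X <> Y /\ (shift_seq (val X) = val Y \/ shift_seq (val Y) = val X).

End Vec.

(* Thinness of a countable better quasi-order; countability and bqo are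
   separate hypotheses wherever this is used. *)
Definition countable_thin (R : realType) (T : Type) (le : T -> T -> Prop) :
    Prop :=
  borel_chromatic_number_le R (@vec_adj T le) 3.

Definition induced (T : Type) (le : T -> T -> Prop) (A : set T) :
    set_type A -> set_type A -> Prop :=
  fun x y => le (val x) (val y).

(* Thinness of a quasi-order not assumed countable. The countable subsets A
   are themselves better quasi-orders, as A inherits this from T. *)
Definition thin (R : realType) (T : Type) (le : T -> T -> Prop) : Prop :=
  bqo le /\
  forall A : set T, A #= [set: nat] -> countable_thin R (@induced T le A).

Definition tree_order (T : Type) (le : T -> T -> Prop) : Prop :=
  [/\ [/\ forall x, le x x,
          forall x y, le x y -> le y x -> x = y
        & forall y x z, le x y -> le y z -> le x z],
      forall t : T, forall A : set T, A `<=` [set v | le v t] -> A !=set0 ->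
        exists2 m, A m & forall v, A v -> le m v
    & exists r : T, forall v, le r v].

(* The class FT_Q. The carrier is an arbitrary type with an explicit order:
   bundling a finPOrderType would put FT_Q in a universe too large for it to
   be given the discrete topology. *)
Record finite_tree (Q : Type) := FiniteTree {
  node : Type ;
  node_le : node -> node -> Prop ;
  node_finite : finite_set [set: node] ;
  node_tree : tree_order node_le ;
  label : node -> Q
}.

Definition node_lt (Q : Type) (t : finite_tree Q) (x y : node t) : Prop :=
  node_le x y /\ x <> y.

Definition tree_le1 (Q : Type) (leQ : Q -> Q -> Prop)
    (t1 t2 : finite_tree Q) : Prop :=
  exists f : node t1 -> node t2,
    (forall x y, node_lt x y -> node_lt (f x) (f y)) /\
    (forall x, leQ (label x) (label (f x))).

(* Main.v *)
Require Import Defs.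
From mathcomp Require Import all_boot all_order all_algebra.
From mathcomp Require Import all_classical all_reals all_analysis.
From HB Require Import structures.

(** Call a sequence of elements of a quasi-order bad if no term is below its
    successor.  The proof rests on finite Borel colorings of bad sequences,
    that is, Borel functions [c] with finitely many values such that a bad [X]
    and its shift receive different values.

    Such a coloring carries everything that thinness asks for.  Any finite
    number of colors can be lowered to three ([coloring_three]).  A coloring
    also gives the better quasi-order property ([coloring_bqo]): if a Borel
    array [f] violates it then, by the Galvin-Prikry theorem, on some set of
    the form [[A]^omega] all the sequences f(B), f(B minus its minimum), ...
    are bad, and on a smaller set of this form their color is constant,
    although B and B minus its minimum have different colors.  So a finite
    Borel coloring of the bad sequences of trees has to be made out of one of
    the bad sequences in [Q].

    For this it suffices to have a Borel function [F] from sequences of trees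
    to [Q] such that, when [X] is bad, the sequence F(X), F(shift X), ... does
    not ascend at every step ([transfer_coloring]).  Indeed, if ascending and
    non-ascending steps both occur, then the kind of the first step and the
    parity of the time until the kind changes color [X]; otherwise no step is
    ascending and the sequence is itself bad in [Q].

    It remains to choose a label canonically.  When a tree [t] does not map to
    a tree [s], a refuter answers each climb of an opponent in [s] by a climb
    in [t] ([refutes_exists]): opposite to a node [y] stands [answer y], and
    once the opponent goes above [y] the refuter may be at [advance y], which
    is strictly higher than [answer y] unless the label of [answer y] is not
    below that of [y].  In a bad sequence of trees the climbs of the refuter in
    one tree serve as those of his opponent in the next game.  A thread is a
    sequence of nodes, one in each tree, each at most the answer to the next
    one.  There may be many threads, and incomparable ones, so consider in each
    tree only the nodes that are comparable with all nodes starting a thread,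
    and among these the nodes that start a thread made of such nodes.  They
    form a chain, the trunk, whose largest element is the tip; [F] is the label
    of the tip.  If the labels of the tips ascended at every step, the
    advance on the next tip would lie strictly above the tip while still in
    the trunk, a contradiction ([tip_label_bad]).  As the trees are finite,
    starting a thread is by compactness a countable intersection of conditions
    on finitely many trees, which makes [F] Borel ([borel_tip_label]). *)

Set Implicit Arguments.
Unset Strict Implicit.
Unset Printing Implicit Defensive.

Local Open Scope classical_set_scope.

(** * Borel sets and Borel maps *)

Section Borel.
Context {X : topologicalType}.
Implicit Types A B : set X.

Lemma borel_open A : open A -> borel A.
Proof. by move=> oA; apply: sub_sigma_algebra. Qed.

Lemma borelC A : borel A -> borel (~` A).
Proof. by rewrite -setTD; exact: sigma_algebraCD. Qed.

Lemma borelN (P : X -> Prop) : borel [set x | P x] -> borel [set x | ~ P x].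
Proof. exact: borelC. Qed.

Lemma borel_ex (P : nat -> X -> Prop) :
  (forall n, borel [set x | P n x]) -> borel [set x | exists n, P n x].
Proof.
move=> bP; have -> : [set x | exists n, P n x] = \bigcup_n [set x | P n x].
  by apply/seteqP; split=> x [n]; [exists n | move=> _; exists n].
exact: sigma_algebra_bigcup.
Qed.

Lemma borel_all (P : nat -> X -> Prop) :
  (forall n, borel [set x | P n x]) -> borel [set x | forall n, P n x].
Proof.
move=> bP; have -> : [set x | forall n, P n x] = [set x | ~ exists n, ~ P n x].
  apply/seteqP; split=> x /= h; first by case=> n; apply.
  by move=> n; apply: contrapT => hn; apply: h; exists n.
apply: borelN; apply: borel_ex => n; apply: borelN; exact: bP.
Qed.

Lemma borel_cst (P : Prop) : borel [set _ : X | P].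
Proof.
have [p|np] := EM P; apply: borel_open.
  by rewrite (_ : [set _ | P] = setT); [exact: openT | apply/seteqP; split].
by rewrite (_ : [set _ | P] = set0); [exact: open0 | apply/seteqP; split].
Qed.

Lemma borel_and (P Q : X -> Prop) :
  borel [set x | P x] -> borel [set x | Q x] -> borel [set x | P x /\ Q x].
Proof.
move=> bP bQ; have -> : [set x | P x /\ Q x] =
    [set x | forall n : nat, if n is 0 then P x else Q x].
  apply/seteqP; split=> x /=; first by case=> p q [].
  by move=> h; split; [exact: (h 0) | exact: (h 1)].
by apply: borel_all => -[].
Qed.

Lemma borel_or (P Q : X -> Prop) :
  borel [set x | P x] -> borel [set x | Q x] -> borel [set x | P x \/ Q x].
Proof.
move=> bP bQ; have -> : [set x | P x \/ Q x] =
    [set x | exists n : nat, if n is 0 then P x else Q x].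
  apply/seteqP; split=> x /=; first by case=> h; [exists 0 | exists 1].
  by case=> -[] h; [left | right].
by apply: borel_ex => -[].
Qed.

Lemma borel_imp (P Q : X -> Prop) :
  borel [set x | P x] -> borel [set x | Q x] -> borel [set x | P x -> Q x].
Proof.
move=> bP bQ; have -> : [set x | P x -> Q x] = [set x | ~ P x \/ Q x].
  apply/seteqP; split=> x /= h; first by have [/h|] := EM (P x); [right|left].
  by case: h.
by apply: borel_or => //; exact: borelN.
Qed.

End Borel.

Lemma borel_preimage (X Y : topologicalType) (f : X -> Y) (B : set Y) :
  borel_map f -> borel B -> borel (f @^-1` B).
Proof.
move=> bf; apply: (@smallest_sub _ _ _ [set B | borel (f @^-1` B)]); last exact: bf.
split=> [|A bA|A bA] /=.
- by rewrite preimage_set0; exact: (borel_cst False).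
- by rewrite setTD preimage_setC; exact: borelC.
- by rewrite preimage_bigcup; exact: sigma_algebra_bigcup.
Qed.

Lemma continuous_borel_map (X Y : topologicalType) (f : X -> Y) :
  continuous f -> borel_map f.
Proof. by move=> /continuousP cf U /cf; exact: borel_open. Qed.

Definition agree (K : Type) (n : nat) (X Y : nat -> K) : Prop :=
  forall i, (i < n)%N -> X i = Y i.

Section Prefix.
Context {K : discreteTopologicalType}.
Local Notation KN := (prod_topology (fun _ : nat => K)).
Implicit Types U : set KN.

Lemma open_agreeP U :
  open U <-> forall X, U X -> exists n, forall Y, agree n X Y -> U Y.
Proof.
split=> [oU X UX|h].
  apply: contrapT => /forallNP nU.
  have /choice[Y Yn] : forall n, exists Y, agree n X Y /\ ~ U Y.
    by move=> n; have /existsNP[Y /not_implyP] := nU n; exists Y.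
  have : Y @ \oo --> X.
    apply/cvg_sup => i A [_ [[B oB <-] BX] BA]; apply: filterS BA _.
    exists i.+1 => // m /= im; have [e _] := Yn m.
    by rewrite /preimage /= -(e i).
  move=> /(_ U (open_nbhs_nbhs _)); case=> // m _ /(_ m) /=.
  by have [_ n /(_ (leqnn m))] := Yn m.
rewrite openE => X /h[n nU]; apply: (filterS nU).
elim: n {nU} => [|n IH]; first by apply: filterS filterT => Y _ i.
have : nbhs X (@proj _ (fun=> K) n @^-1` [set X n]).
  by apply: proj_continuous; exact: discrete_set1.
apply: filterS2 IH => Y a e i; rewrite ltnS leq_eqVlt => /orP[/eqP->|/a //].
by rewrite -e.
Qed.

End Prefix.

Definition borel_nat (X : topologicalType) (f : X -> nat) : Prop :=
  forall i, borel [set x | f x = i].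

Section BorelNat.
Context {X : topologicalType}.
Implicit Types f g h : X -> nat.

Lemma borel_nat_rel f g (P : nat -> nat -> Prop) :
  borel_nat f -> borel_nat g -> borel [set x | P (f x) (g x)].
Proof.
move=> bf bg; have -> : [set x | P (f x) (g x)] =
    [set x | exists i, exists j, f x = i /\ (g x = j /\ P i j)].
  apply/seteqP; split=> x /=; first by exists (f x), (g x).
  by case=> i [j [<- [<-]]].
apply: borel_ex => i; apply: borel_ex => j; apply: borel_and; first exact: bf.
by apply: borel_and; [exact: bg | exact: borel_cst].
Qed.

Lemma borel_nat2 f g (F : nat -> nat -> nat) :
  borel_nat f -> borel_nat g -> borel_nat (fun x => F (f x) (g x)).
Proof. by move=> bf bg i; exact: (borel_nat_rel (fun a b => F a b = i)). Qed.

Lemma borel_nat_if (P : X -> Prop) f g :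
  borel [set x | P x] -> borel_nat f -> borel_nat g ->
  borel_nat (fun x => if `[< P x >] then f x else g x).
Proof.
move=> bP bf bg i; have -> : [set x | (if `[< P x >] then f x else g x) = i] =
    [set x | (P x /\ f x = i) \/ (~ P x /\ g x = i)].
  apply/seteqP; split=> x /=; first by case: asboolP => px e; [left|right].
  by case: asboolP => px [[]|[]].
by apply: borel_or; apply: borel_and => //; exact: borelN.
Qed.

End BorelNat.

Lemma borel_nat_comp (X Y : topologicalType) (f : X -> Y) (g : Y -> nat) :
  borel_map f -> borel_nat g -> borel_nat (g \o f).
Proof. by move=> bf bg i; exact: borel_preimage bf (bg i). Qed.

(** Only countably many terms occur, so the open sets that matter are countable
    unions of cylinders, even when [T] itself is uncountable. *)
Lemma borel_seq_map (Z : topologicalType) (T : Type) (F : Z -> seqspace T)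
    (code : T -> nat) :
  (forall z z' m m', code (F z m) = code (F z' m') -> F z m = F z' m') ->
  (forall m, borel_nat (fun z => code (F z m))) -> borel_map F.
Proof.
move=> code_inj bF U /open_agreeP oU.
pose C s z := forall i, (i < size s)%N -> code (F z i) = nth 0 s i.
have bC s : borel [set z | C s z].
  rewrite /C; apply: borel_all => i; apply: borel_imp; first exact: borel_cst.
  exact: bF.
pose dec n : seq nat := odflt [::] (unpickle n).
have -> : F @^-1` U =
    [set z | exists n, (forall z', C (dec n) z' -> U (F z')) /\ C (dec n) z].
  apply/seteqP; split=> z /=; last by case=> n [sU]; exact: sU.
  move=> /oU[n nU]; pose s := mkseq (fun i => code (F z i)) n.
  exists (pickle s); rewrite /dec pickleK /=; split=> [z' Cz'|]; last first.
    by move=> i; rewrite size_mkseq => ni; rewrite nth_mkseq.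
  apply: nU => i ni; apply: code_inj.
  by rewrite Cz' ?size_mkseq // nth_mkseq.
by apply: borel_ex => n; apply: borel_and; [exact: borel_cst | exact: bC].
Qed.

Lemma borel_nat_bool (X : topologicalType) (s : X -> bool) :
  borel [set x | s x] -> borel_nat (fun x => s x : nat).
Proof.
move=> bs; case=> [|[|i]].
- rewrite (_ : [set x | _] = [set x | ~ s x]); first exact: borelN.
  by apply/seteqP; split=> x /=; case: (s x).
- rewrite (_ : [set x | _] = [set x | s x]) //.
  by apply/seteqP; split=> x /=; case: (s x).
- rewrite (_ : [set x | _] = [set _ | False]); first exact: borel_cst.
  by apply/seteqP; split=> x /=; case: (s x).
Qed.

(** * The Galvin-Prikry theorem *)

Definition unbounded (A : set nat) : Prop := forall n, exists2 m, (n < m)%N & A m.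

Definition above (A : set nat) (m : nat) : set nat := [set k | A k /\ (m < k)%N].

Lemma unbounded_above A m : unbounded A -> unbounded (above A m).
Proof.
move=> uA n; have [k + Ak] := uA (maxn n m).
by rewrite gtn_max => /andP[nk mk]; exists k.
Qed.

Lemma incseqP (X : incseq) : strictly_increasing (val X).
Proof. by case: X => s /= /set_mem. Qed.

Lemma unbounded_incseq A : unbounded A -> exists X : incseq, range (val X) `<=` A.
Proof.
move=> uA; have /choice[g gP] : forall n, exists m, (n < m)%N /\ A m.
  by move=> n; have [m] := uA n; exists m.
pose s i := iter i.+1 g 0.
have s_inc : strictly_increasing s.
  move=> i j; elim: j => // j IH; rewrite ltnS leq_eqVlt => /orP[/eqP->|/IH].
    exact: (gP _).1.
  by move=> ij; exact: ltn_trans ij (gP _).1.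
exists (exist _ s (mem_set s_inc)) => _ [i _ <-] /=.
exact: (gP _).2.
Qed.

Lemma strictly_increasing_lt s i j :
  strictly_increasing s -> (s i < s j)%N -> (i < j)%N.
Proof.
move=> si sij; rewrite ltnNge; apply/negP; rewrite leq_eqVlt => /orP[/eqP e|/si].
  by move: sij; rewrite e ltnn.
by move/ltnW; rewrite leqNgt sij.
Qed.

(** The finite subsets of [[0, m]], as increasing lists. *)
Definition sorted_upto (m : nat) : seq (seq nat) :=
  [seq mask w (iota 0 m.+1) | w : m.+1.-tuple bool].

Lemma sorted_uptoP m b :
  sorted ltn b -> all (leq^~ m) b -> b \in sorted_upto m.
Proof.
move=> sb bm; have -> : b = mask (map (mem b) (iota 0 m.+1)) (iota 0 m.+1).
  rewrite -filter_mask; apply: (irr_sorted_eq ltn_trans ltnn) => //.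
    by apply: sorted_filter; [exact: ltn_trans | exact: iota_ltn_sorted].
  move=> i; rewrite mem_filter mem_iota /= add0n ltnS.
  by apply/idP/andP=> [ib|[]//]; split=> //; exact: (allP bm).
have sz : size [seq mem b i | i <- iota 0 m.+1] == m.+1 by rewrite size_map size_iota.
by apply/mapP; exists (Tuple sz); rewrite // mem_enum.
Qed.

(** Diagonalization: a property of a finite set and an infinite set that is
    inherited by infinite subsets and can be reached below every infinite set
    can be reached for all finite subsets of one infinite set at once.  The
    property only concerns the members of the infinite set beyond the maximum
    of the finite set, whence [Phi_above]. *)
Section Fusion.
Variable Phi : seq nat -> set nat -> Prop.
Variable A : set nat.
Hypothesis Phi_sub : forall b (Y Z : set nat), Z `<=` Y -> Phi b Y -> Phi b Z.
Hypothesis Phi_dense : forall b Y, Y `<=` A -> unbounded Y ->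
  exists Z, [/\ Z `<=` Y, unbounded Z & Phi b Z].
Hypothesis Phi_above : forall b m Y, Phi (rcons b m) (above Y m) -> Phi (rcons b m) Y.

Lemma dense_all (l : seq (seq nat)) Y : Y `<=` A -> unbounded Y ->
  exists Z, [/\ Z `<=` Y, unbounded Z & forall b, b \in l -> Phi b Z].
Proof.
move=> YA uY; elim: l => [|b l [Z [ZY uZ IH]]]; first by exists Y; split.
have [W [WZ uW PW]] := Phi_dense b (subset_trans ZY YA) uZ.
exists W; split=> // [|c]; first exact: subset_trans WZ ZY.
by rewrite inE => /orP[/eqP->//|/IH]; exact: Phi_sub.
Qed.

Lemma fusion : unbounded A -> exists Z, [/\ Z `<=` A, unbounded Z &
  forall b, sorted ltn b -> (forall i, i \in b -> Z i) -> Phi b Z].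
Proof.
move=> uA; pose good Y := Y `<=` A /\ unbounded Y.
have /choice[f fP] : forall Y, exists mZ : nat * set nat, good Y ->
    [/\ Y mZ.1, mZ.2 `<=` above Y mZ.1, unbounded mZ.2 &
      forall b, b \in sorted_upto mZ.1 -> Phi b mZ.2].
  move=> Y; have [gY|nY] := pselect (good Y); last by exists (0, Y) => /nY.
  have [m _ Ym] := gY.2 0.
  have /(dense_all (sorted_upto m)) : above Y m `<=` A by move=> k [/gY.1].
  case/(_ (unbounded_above m gY.2)) => Z [ZY uZ PZ].
  by exists (m, Z).
(* [z n] is taken in [Y n], and [Y n.+1] serves all finite sets with maximum
   [z n]. *)
have [Y0 [Y0A uY0 PY0]] := Phi_dense [::] (@subset_refl _ A) uA.
pose Y n := iter n (fun Y => (f Y).2) Y0; pose z n := (f (Y n)).1.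
have gY n : good (Y n).
  elim: n => [|n [YnA uYn]]; first by split.
  have [_ sub uf _] := fP _ (conj YnA uYn).
  by split=> // k /sub[/YnA].
have YS n : Y n.+1 `<=` above (Y n) (z n) by have [] := fP _ (gY n).
have Y_le m n : (m <= n)%N -> Y n `<=` Y m.
  elim: n => [|n IH]; first by rewrite leqn0 => /eqP->.
  rewrite leq_eqVlt => /orP[/eqP->//|]; rewrite ltnS => /IH.
  by apply: subset_trans => k /YS[].
have zY n : Y n (z n) by have [] := fP _ (gY n).
have zlt m n : (m < n)%N -> above (Y m) (z m) (z n).
  by move=> mn; apply: YS; apply: Y_le mn _ (zY n).
have z_inc : strictly_increasing z by move=> m n /zlt[].
have zn n : (n <= z n)%N.
  by elim: n => // n IH; apply: leq_ltn_trans IH (z_inc _ _ _).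
exists (range z); split.
- by move=> _ [n _ <-]; apply: (gY n).1.
- by move=> n; exists (z n.+1); [exact: zn | exists n.+1].
elim/last_ind => [_ _|b m _ sb bz].
  by apply: Phi_sub PY0 => _ [n _ <-]; exact: (Y_le 0 n) (zY n).
have [n _ nm] : range z m by apply: bz; rewrite mem_rcons mem_head.
apply: Phi_above; have [_ _ _] := fP _ (gY n).
rewrite -/(z n) nm => PYn; apply: (Phi_sub (Y := (f (Y n)).2)); last first.
  apply: PYn; apply: sorted_uptoP => //; rewrite all_rcons leqnn /=.
  have : sorted leq (rcons b m) by apply: sub_sorted sb => i j /ltnW.
  move=> sb'; apply/allP => i ib.
  have := sorted_ltn_nth ltn_trans 0 sb (index i b) (size b).
  rewrite !inE !size_rcons !ltnS leqnn index_size => /(_ isT isT).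
  rewrite index_mem ib => /(_ isT).
  by rewrite !nth_rcons index_mem ib nth_index // ltnn eqxx => /ltnW.
move=> _ [[k _ <-]]; rewrite -nm => /(strictly_increasing_lt z_inc) nk.
exact: Y_le nk _ (zY k).
Qed.

End Fusion.

(** The basic open set [[b, A]] of the Ellentuck topology. *)
Definition ellentuck (b : seq nat) (A : set nat) : set incseq :=
  [set X | mkseq (val X) (size b) = b /\ forall i, (size b <= i)%N -> A (val X i)].

Definition decides (U : set incseq) b A := ellentuck b A `<=` U \/ ellentuck b A `<=` ~` U.

Lemma ellentuck_sub b A B : A `<=` B -> ellentuck b A `<=` ellentuck b B.
Proof. by move=> AB X [Xb XA]; split=> // i /XA/AB. Qed.

Lemma ellentuck_above b m A :
  ellentuck (rcons b m) A `<=` ellentuck (rcons b m) (above A m).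
Proof.
move=> X [Xb XA]; split=> // i bi; split; first exact: XA.
move: Xb bi; rewrite size_rcons mkseqS => /rcons_inj[_ <-]; exact: incseqP.
Qed.

Lemma ellentuck_rcons b A X : ellentuck b A X -> ellentuck (rcons b (val X (size b))) A X.
Proof.
move=> [Xb XA]; split; first by rewrite size_rcons mkseqS Xb.
by move=> i; rewrite size_rcons => /ltnW; exact: XA.
Qed.

Lemma decides_sub U b A B : A `<=` B -> decides U b B -> decides U b A.
Proof.
by move=> AB [] h; [left|right]; apply: subset_trans h; exact: ellentuck_sub.
Qed.

Lemma decides_above U b m A :
  decides U (rcons b m) (above A m) -> decides U (rcons b m) A.
Proof.
by move=> [] h; [left|right]; apply: subset_trans h; exact: ellentuck_above.
Qed.

Definition segment (X : incseq) m n := mkseq (fun i => val X (m + i)) n.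

Lemma mkseq_segment X m n :
  mkseq (val X) (m + n) = mkseq (val X) m ++ segment X m n.
Proof.
rewrite /mkseq iotaD map_cat add0n /segment /mkseq.
by rewrite -[in iota m n](addn0 m) iotaDl -map_comp.
Qed.

Lemma segment_sorted X m n : sorted ltn (segment X m n).
Proof.
apply: (homo_sorted (e := ltn)) (iota_ltn_sorted 0 n) => i j ij.
by apply: incseqP; rewrite ltn_add2l.
Qed.

Lemma mem_segment X m n i : i \in segment X m n -> exists2 k, (m <= k)%N & i = val X k.
Proof. by move=> /mapP[k _ ->]; exists (m + k); rewrite ?leq_addr. Qed.

(** Galvin's combinatorial forcing.  Pass to [Y] on which each finite set is
    decided: either all its extensions into [Y] are in [U], or the same holds
    for no infinite subset of [Y].  If [b0] is of the second kind, then so are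
    almost all its one-point extensions, and a second fusion makes all finite
    extensions of [b0] of the second kind; no point of [U] is left, since [U]
    is entered at some finite stage. *)
Section Forcing.
Variables (U : set incseq) (b0 : seq nat) (A : set nat).
Hypothesis uA : unbounded A.
Hypothesis U_local : forall X, ellentuck b0 A X -> U X ->
  exists2 n, (size b0 <= n)%N & ellentuck (mkseq (val X) n) A `<=` U.

Let rejects b (Y : set nat) :=
  forall Z, Z `<=` Y -> unbounded Z -> ~ ellentuck b Z `<=` U.

Lemma decide_local : exists Z, [/\ Z `<=` A, unbounded Z & decides U b0 Z].
Proof.
have [|||//|Y [YA uY YP]] := @fusion
  (fun b Y => ellentuck (b0 ++ b) Y `<=` U \/ rejects (b0 ++ b) Y) A.
- move=> b Y Z ZY [h|h]; [left|right].
    by apply: subset_trans h; exact: ellentuck_sub.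
  by move=> W WZ; apply: h; exact: subset_trans ZY.
- move=> b Y _ uY; have [rY|nY] := EM (rejects (b0 ++ b) Y).
    by exists Y; split=> //; right.
  have /existsNP[Z /not_implyP[ZY /not_implyP[uZ /contrapT h]]] := nY.
  by exists Z; split=> //; left.
- move=> b m Y; rewrite -rcons_cat => -[h|h]; [left|right].
    by apply: subset_trans h; exact: ellentuck_above.
  move=> Z ZY uZ ZU; apply: (h (above Z m)).
  + by move=> k [/ZY].
  + exact: unbounded_above.
  + by apply: subset_trans ZU; apply: ellentuck_sub => k [].
have /= [] := YP [::] isT (fun i => ltac:(by [])); rewrite cats0 => h0.
  by exists Y; split=> //; left.
have [|||//|Z [ZY uZ ZP]] := @fusion (fun b Z => sorted ltn b ->
    (forall i, i \in b -> Y i) -> rejects (b0 ++ b) Y ->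
    forall m, Z m -> all (ltn^~ m) b -> rejects (b0 ++ rcons b m) Y) Y.
- by move=> b Z W WZ h sb bY rb m /WZ; exact: h.
- move=> b Z ZY uZ.
  have [[sb bY rb]|nb] := EM [/\ sorted ltn b, forall i, i \in b -> Y i
      & rejects (b0 ++ b) Y]; last by exists Z; split=> // *; case: nb.
  pose W : set nat := [set m | [/\ Z m, all (ltn^~ m) b & ~ rejects (b0 ++ rcons b m) Y]].
  have [uW|/existsNP[N nW]] := EM (unbounded W).
    (* An infinite [W] would accept [b0 ++ b]: every point of its neighborhood
       lies in the neighborhood of an accepted one-point extension. *)
    case: (rb W) => // [m []|X XW]; first by move=> /ZY.
    have Wm : W (val X (size (b0 ++ b))) by apply: XW.2.
    have [Zm bm nr] := Wm.
    have /YP : sorted ltn (rcons b (val X (size (b0 ++ b)))).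
      have := bm; case: (b) sb => //= i c pc /andP[ic cm].
      rewrite rcons_path pc /=; have := mem_last i c; rewrite inE.
      by move=> /orP[/eqP->//|]; exact: (allP cm).
    case=> [i|h|//]; first by rewrite mem_rcons inE => /orP[/eqP->|/bY //]; exact: ZY.
    apply: h; rewrite -rcons_cat; apply: ellentuck_rcons; move: XW; apply: ellentuck_sub.
    by move=> k []/ZY.
  exists (above Z N); split=> [k []//||_ _ _ m [Zm Nm] bm]; first exact: unbounded_above.
  by apply: contrapT => nr; apply: nW; exists m.
- move=> b m Z h sb bY rb k Zk bk; apply: h => //; split=> //.
  by move: bk; rewrite all_rcons => /andP[].
have rZ b : sorted ltn b -> (forall i, i \in b -> Z i) -> rejects (b0 ++ b) Y.
  elim/last_ind: b => [|b m IH] sb bZ; first by rewrite cats0.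
  have bZ' i : i \in b -> Z i by move=> ib; apply: bZ; rewrite mem_rcons inE ib orbT.
  have sb' : sorted ltn b by move: sb; apply: prefix_sorted; exact: prefix_rcons.
  apply: ZP => //; first by move=> i /bZ'/ZY.
  - exact: IH.
  - by apply: bZ; rewrite mem_rcons mem_head.
  have := sb; rewrite (sorted_pairwise (leT := ltn)); last exact: ltn_trans.
  by rewrite pairwise_rcons => /andP[].
exists Z; split=> //; first exact: subset_trans ZY YA.
right=> X XZ UX; have [|n bn nU] := U_local _ UX.
  by move: XZ; apply: ellentuck_sub; exact: subset_trans YA.
have e : mkseq (val X) n = b0 ++ segment X (size b0) (n - size b0).
  by rewrite -[in LHS](subnKC bn) mkseq_segment XZ.1.
apply: (rZ _ (segment_sorted X (size b0) (n - size b0))) uY _ => //.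
- by move=> i /mem_segment[k kb ->]; exact: XZ.2.
- by rewrite -e; apply: subset_trans nU; exact: ellentuck_sub.
Qed.

End Forcing.

Definition completely_ramsey (U : set incseq) : Prop := forall b A, unbounded A ->
  exists Z, [/\ Z `<=` A, unbounded Z & decides U b Z].

Lemma open_incseq (U : set incseq) : open U ->
  forall X, U X -> exists n, forall Y, agree n (val X) (val Y) -> U Y.
Proof.
by case=> O oO <- X /((open_agreeP _).1 oO)[n nO]; exists n => Y; exact: nO.
Qed.

Lemma completely_ramsey_open U : open U -> completely_ramsey U.
Proof.
move=> /open_incseq oU b A uA; apply: decide_local => // X _ /oU[n nU].
exists (maxn (size b) n); first exact: leq_maxl.
move=> Y [Ye _]; apply: nU => i ni.
have := congr1 (fun s => nth 0 s i) Ye; rewrite size_mkseq.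
by rewrite !nth_mkseq // leq_max ni orbT.
Qed.

Lemma completely_ramseyC U : completely_ramsey U -> completely_ramsey (~` U).
Proof.
move=> cU b A /(cU b)[Z [ZA uZ dZ]]; exists Z; split=> //.
by case: dZ; [right; rewrite setCK | left].
Qed.

(** A first fusion makes each [U i] decided by every finite set with at least
    [i] further elements, so that the union is entered at a finite stage and
    [decide_local] applies to it. *)
Lemma completely_ramsey_bigcup (U : nat -> set incseq) :
  (forall n, completely_ramsey (U n)) -> completely_ramsey (\bigcup_n U n).
Proof.
move=> cU b0 A uA.
have [|||//|Z [ZA uZ ZP]] := @fusion
  (fun b Y => forall i, (i <= size b)%N -> decides (U i) (b0 ++ b) Y) A.
- by move=> b Y Z ZY h i /h; exact: decides_sub.
- move=> b Y _; elim: (size b) => [|n IH] uY.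
    have [Z [ZY uZ dZ]] := cU 0 (b0 ++ b) Y uY.
    by exists Z; split=> // i; rewrite leqn0 => /eqP->.
  have [Z [ZY uZ dZ]] := IH uY.
  have [W [WZ uW dW]] := cU n.+1 (b0 ++ b) Z uZ.
  exists W; split=> // [|i]; first exact: subset_trans ZY.
  by rewrite leq_eqVlt => /orP[/eqP->//|/dZ]; exact: decides_sub.
- by move=> b m Y h i /h; rewrite -rcons_cat; exact: decides_above.
have [X XZ [i _ UX]|W [WZ uW dW]] := @decide_local (\bigcup_n U n) b0 Z uZ; last first.
  by exists W; split=> //; exact: subset_trans ZA.
exists (size b0 + i); first exact: leq_addr.
have e : mkseq (val X) (size b0 + i) = b0 ++ segment X (size b0) i.
  by rewrite mkseq_segment XZ.1.
have [||h|h] := ZP (segment X (size b0) i) (segment_sorted _ _ _) _ i.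
- by move=> j /mem_segment[k kb ->]; exact: XZ.2.
- by rewrite size_mkseq.
- by rewrite e; apply: subset_trans h _; exact: bigcup_sup.
- case: (h X) => //; rewrite -e; split; first by rewrite size_mkseq.
  move=> k; rewrite size_mkseq => ki; apply: XZ.2.
  by apply: leq_trans ki; rewrite leq_addr.
Qed.

Theorem galvin_prikry (U : set incseq) : borel U -> completely_ramsey U.
Proof.
apply: smallest_sub; last exact: completely_ramsey_open.
split=> [|B|F].
- by apply: completely_ramsey_open; exact: open0.
- by rewrite setTD; exact: completely_ramseyC.
- exact: completely_ramsey_bigcup.
Qed.

(** * Borel colorings of bad sequences *)

Definition bad (T : Type) (le : T -> T -> Prop) (X : nat -> T) : Prop :=
  forall k, ~ le (X k) (X k.+1).

Lemma bad_shift T (le : T -> T -> Prop) X : bad le X -> bad le (shift_seq X).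
Proof. by move=> bX k; exact: bX. Qed.

Definition coloring (T : Type) (le : T -> T -> Prop) (n : nat)
    (c : seqspace T -> nat) : Prop :=
  [/\ forall X, (c X < n)%N, borel_nat c &
      forall X, bad le X -> c X <> c (shift_seq X)].

Lemma shift_borel_map T : borel_map (@shift_seq T : seqspace T -> seqspace T).
Proof.
apply: continuous_borel_map; apply/continuousP => U /open_agreeP oU.
apply/open_agreeP => X /oU[n nU]; exists n.+1 => Y XY.
by apply: nU => i ni; exact: XY.
Qed.

Lemma iter_shift_borel_map T k :
  borel_map (iter k (@shift_seq T) : seqspace T -> seqspace T).
Proof.
elim: k => [|k IH] U oU; first exact: borel_open.
exact: (borel_preimage IH (shift_borel_map oU)).
Qed.

Definition avoid (a b : nat) : nat :=
  if (a != 0) && (b != 0) then 0 else if (a != 1) && (b != 1) then 1 else 2.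

Lemma avoidP a b : [/\ avoid a b <> a, avoid a b <> b & (avoid a b < 3)%N].
Proof. by rewrite /avoid; case: a => [|[|[|a]]]; case: b => [|[|[|b]]]. Qed.

(** Recolor [X] by the color of its shift.  All the predecessors of a vertex then
    have the same color, so a vertex has at most two colors around it, and the
    last color can be replaced by one of the first three. *)
Lemma coloring_pred T (le : T -> T -> Prop) n c :
  coloring le n.+4 c -> exists c', coloring le n.+3 c'.
Proof.
move=> [c_lt c_borel c_ne]; pose S : seqspace T -> seqspace T := @shift_seq T.
pose c' (X : seqspace T) :=
  if `[< c (S X) = n.+3 >] then avoid (c (S (S X))) (c X) else c (S X).
have bcS : borel_nat (c \o S) by exact: borel_nat_comp (@shift_borel_map T) c_borel.
exists c'; split=> [X||X bX].
- rewrite /c'; case: asboolP => ne.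
    by have [_ _ lt3] := avoidP (c (S (S X))) (c X); exact: leq_trans lt3 _.
  by have := c_lt (S X); rewrite ltnS leq_eqVlt => /orP[/eqP|].
- apply: borel_nat_if; [exact: bcS n.+3 | | exact: bcS].
  apply: borel_nat2; last exact: c_borel.
  exact: (borel_nat_comp (@shift_borel_map T) bcS).
have bX1 := bad_shift bX; have bX2 := bad_shift bX1.
rewrite /c'; case: asboolP => e1; case: asboolP => e2.
- by case: (c_ne _ bX1); rewrite -/S e1 -e2.
- by have [] := avoidP (c (S (S X))) (c X).
- have [_ + _] := avoidP (c (S (S (S X)))) (c (S X)).
  by move=> h; apply: nesym.
- exact: c_ne _ bX1.
Qed.

Lemma coloring_three T (le : T -> T -> Prop) n c :
  coloring le n c -> exists c', coloring le 3 c'.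
Proof.
elim: n c => [|n IH] c hc.
  by exists c; case: hc => lt b ne; split=> // X; have := lt X.
have [n3|n3] := leqP n.+1 3.
  by exists c; case: hc => lt b ne; split=> // X; exact: leq_trans (lt X) n3.
case: n n3 IH hc => [|[|[|n]]] // _ IH /coloring_pred[c']; exact: IH.
Qed.

(** * Thinness and colorings *)

(** Borel sets of a Borel subspace are Borel in the whole space; this allows to
    extend a coloring by a constant outside the bad sequences. *)
Lemma borel_image_val (X : topologicalType) (D : set X) (B : set (set_type D)) :
  borel D -> borel B -> borel [set val v | v in B].
Proof.
move=> bD; apply: (@smallest_sub _ _ _ [set B | borel [set val v | v in B]]).
  split=> [|C bC|F bF] /=.
  - by rewrite image_set0; exact: (borel_cst False).
  - have -> : [set val v | v in setT `\` C] = [set x | D x /\ ~ [set val v | v in C] x].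
      apply/seteqP; split=> x /=.
        move=> [[y yD] [_ nC] <-] /=; split; first exact: set_mem.
        by case=> v Cv ve; apply: nC; rewrite (_ : exist _ _ _ = v) //; apply: val_inj.
      move=> [Dx nC]; exists (exist _ x (mem_set Dx)) => //; split=> // Cx.
      by apply: nC; exists (exist _ x (mem_set Dx)).
    by apply: borel_and => //; exact: borelN.
  - by rewrite image_bigcup; exact: sigma_algebra_bigcup.
move=> C [W oW <-] /=.
rewrite (_ : [set val v | v in _] = [set x | D x /\ W x]).
  by apply: borel_and => //; exact: borel_open.
apply/seteqP; split=> x /=; first by case=> [[y yD]] Oy <-; split=> //; exact: set_mem.
by move=> [Dx Ox]; exists (exist _ x (mem_set Dx)).
Qed.

Lemma prefix_borel T n (P : seqspace T -> Prop) :
  (forall X Y, agree n X Y -> P X -> P Y) -> borel [set X | P X].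
Proof.
move=> nP; apply: borel_open; apply/open_agreeP => X PX.
by exists n => Y /nP; exact.
Qed.

Lemma bad_borel T (le : T -> T -> Prop) : borel [set X : seqspace T | bad le X].
Proof.
apply: borel_all => k; apply: (@prefix_borel _ k.+2) => X Y XY.
by rewrite (XY k) // (XY k.+1).
Qed.

Lemma polish_closed1 (R : realType) (Y : topologicalType) (y : Y) :
  polish R Y -> closed [set y].
Proof.
move=> [_ [M _ [f [g [fK _ cf _]]]]].
have -> : [set y] = f @^-1` [set f y].
  by apply/seteqP; split=> x /= => [->//|]; exact: can_inj.
move/continuousP : cf => cf; rewrite -openC preimage_setC; apply: cf.
rewrite openC; apply: accessible_closed_set1; apply: hausdorff_accessible.
exact: metric_hausdorff.
Qed.

(** Points are closed in a Polish space, hence the color classes are Borel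
    whatever the space of colors is. *)
Lemma thin_coloring (R : realType) T (le : T -> T -> Prop) :
  (forall x, le x x) -> countable_thin R le -> exists c, coloring le 3 c.
Proof.
move=> le_refl [Y [pY Y3 [c [bc cE]]]].
have [j j3 j_inj] : exists2 j : Y -> nat, forall y, (j y < 3)%N & injective j.
  have /pcard_leP[j] := Y3.
  exists j => [y|x y]; first exact: (@funS _ _ _ _ j y I).
  by apply: inj; rewrite inE.
pose jc v := j (c v).
have bjc i : borel [set v | jc v = i].
  have [[y yi]|nj] := EM (exists y, j y = i); last first.
    rewrite (_ : [set _ | _] = [set _ | False]); first exact: borel_cst.
    by apply/seteqP; split=> v //= e; apply: nj; exists (c v).
  rewrite (_ : [set _ | _] = ~` (c @^-1` (~` [set y]))); last first.
    rewrite preimage_setC setCK; apply/seteqP; split=> v /=; rewrite -yi.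
      by move/j_inj.
    by rewrite /jc => ->.
  by apply: borelC; apply: bc; rewrite openC; exact: polish_closed1 pY.
pose c' (X : seqspace T) : nat :=
  if pselect (bad le X) is left bX then jc (exist _ X (mem_set bX)) else 0.
have c'E X : forall bX : bad le X, c' X = jc (exist _ X (mem_set bX)).
  by move=> bX; rewrite /c'; case: pselect => // bX'; rewrite (Prop_irrelevance bX bX').
exists c'; split=> [X|i|X bX].
- by rewrite /c'; case: pselect => // bX; exact: j3.
- have -> : [set X | c' X = i] = [set X | [set val v | v in [set v | jc v = i]] X \/
     (~ bad le X /\ 0 = i)].
    apply/seteqP; split=> X /=.
      rewrite /c'; case: pselect => bX e; last by right.
      by left; exists (exist _ X (mem_set bX)).
    case=> [[[Y' bY] /= e <-]|[nb <-]]; last by rewrite /c'; case: pselect.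
    have bY' := set_mem bY; rewrite (c'E _ bY') -e; congr jc.
    exact: val_inj.
  apply: borel_or; last first.
    by apply: borel_and; [apply: borelN; exact: bad_borel | exact: borel_cst].
  by apply: borel_image_val => //; exact: bad_borel.
rewrite (c'E _ bX) (c'E _ (bad_shift bX)) => /j_inj; apply: cE; split; last by left.
move=> /(congr1 val) /= /(congr1 (fun f => f 0)) /= e.
by apply: (bX 0); rewrite [X in le X]e.
Qed.

(** The parameter serves to make the distance real-valued in [R]. *)
Definition three_points (R : realType) : Type := 'I_3.

Section ThreePoints.
Variable R : realType.
Import Order.TTheory GRing.Theory Num.Theory.
Local Open Scope ring_scope.
Local Notation T := (three_points R).

HB.instance Definition _ := Finite.copy T 'I_3.

Definition discrete_dist (x y : T) : R := (x != y)%:R.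

Lemma discrete_distxx x : discrete_dist x x = 0.
Proof. by rewrite /discrete_dist eqxx. Qed.

Lemma discrete_dist_eq0 x y : discrete_dist x y = 0 -> x = y.
Proof. by rewrite /discrete_dist; case: eqP => // _ /eqP; rewrite oner_eq0. Qed.

Lemma discrete_dist_sym x y : discrete_dist x y = discrete_dist y x.
Proof. by rewrite /discrete_dist eq_sym. Qed.

Lemma discrete_dist_triangle y x z :
  discrete_dist x z <= discrete_dist x y + discrete_dist y z.
Proof.
rewrite /discrete_dist -natrD ler_nat.
by case: (eqVneq x z) => // xz; case: (eqVneq x y) => [<-|]; rewrite ?xz.
Qed.

HB.instance Definition _ := isMetric.Build R T discrete_distxx discrete_dist_eq0
  discrete_dist_sym discrete_dist_triangle.

Lemma three_points_ball (x : T) : ball x (1 : R) = [set x].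
Proof.
rewrite ballEmdist; apply/seteqP; split=> y /=; last by move=> ->; rewrite mdistxx.
rewrite /mdist /= /discrete_dist; case: eqP => [->//|_].
by rewrite ltxx.
Qed.

Lemma three_points_polish : polish R T.
Proof.
split.
  exists setT; first by apply: finite_set_countable; exact: finite_finset.
  by move=> U [x Ux] _; exists x.
exists T; last first.
  by exists id, id; split=> // x; exact: cvg_id.
move=> F PF /cauchyP/(_ 1 ltr01)[x]; rewrite three_points_ball => Fx.
by exists x => U /nbhs_singleton Ux; apply: filterS Fx => _ ->.
Qed.

End ThreePoints.

Lemma coloring_thin (R : realType) T (le : T -> T -> Prop) c (A : set T) :
  coloring le 3 c -> countable_thin R (@Defs.induced T le A).
Proof.
move=> [c3 bc cS]; exists (three_points R); split.
- exact: three_points_polish.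
- by have := @card_II 3; rewrite card_eq_le => /andP[_].
pose i (v : vec (@Defs.induced T le A)) : seqspace T := fun k => val (val v k).
have bi : borel_map i.
  apply: continuous_borel_map; apply/continuousP => U /open_agreeP oU.
  exists (fun Y => U (fun k => val (Y k))) => //.
  apply/open_agreeP => X /oU[n nU]; exists n => Y XY.
  by apply: nU => j jn; rewrite (XY j jn).
have i_bad v : bad le (i v) by case: v => X p; exact: (set_mem p).
exists (fun v => Ordinal (c3 (i v)) : three_points R); split.
  move=> U _.
  rewrite (_ : _ @^-1` U = i @^-1` [set X | U (Ordinal (c3 X) : three_points R)]) //.
  apply: borel_preimage bi _.
  rewrite (_ : [set X | _] =
      [set X | exists k, c X = k /\ exists2 k3 : (k < 3)%N, U (Ordinal k3) & True]).
    by apply: borel_ex => k; apply: borel_and; [exact: bc | exact: borel_cst].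
  apply/seteqP; split=> X /=.
    by move=> UX; exists (c X); split=> //; exists (c3 X).
  move=> [k [cX [k3 Uk _]]]; rewrite (_ : Ordinal (c3 X) = Ordinal k3 :> 'I_3) //.
  exact: val_inj.
suff main v w : shift_seq (val v) = val w -> c (i v) <> c (i w).
  by move=> v w [_ [/main|/main]] h /(congr1 val) //= /esym.
move=> vw; have -> : i w = shift_seq (i v) by rewrite /i -vw.
exact: cS.
Qed.

(** * Better quasi-orders from colorings *)

(** The map [code] has countable range and determines an element up to
    equivalence: arrays in an uncountable class are treated through it. *)
Section ColoringBqo.
Variables (T : Type) (le : T -> T -> Prop) (code : T -> nat).
Hypothesis le_trans : forall y x z, le x y -> le y z -> le x z.
Hypothesis code_le : forall t t', code t = code t' -> le t t'.

Lemma remove_min_borel_map k : borel_map (iter k remove_min).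
Proof.
have b1 : borel_map remove_min.
  move=> U [W oW <-]; apply: borel_open; exists (@shift_seq nat @^-1` W) => //.
  apply/open_agreeP => X; move/open_agreeP : oW => h /h[n nW].
  by exists n.+1 => Y XY; apply: nW => i ni; exact: XY.
elim: k => [|k IH] U oU; first exact: borel_open.
exact: (borel_preimage IH (b1 _ oU)).
Qed.

Lemma coloring_bqo c : coloring le 3 c ->
  forall f : incseq -> discrete T, borel_map f ->
    exists A : incseq, forall B : incseq, subseq_of A B ->
      le (f B) (f (remove_min B)).
Proof.
move=> [c3 bc cS] f bf.
have uT : unbounded setT by move=> n; exists n.+1.
have [B0 _] := unbounded_incseq uT.
have /choice[h hP] : forall i, exists t, forall t', code t' = i -> code t = i.
  move=> i; have [[t ti]|ni] := EM (exists t, code t = i); first by exists t.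
  by exists (f B0) => t' ti; case: ni; exists t'.
have bcf k : borel_nat (fun B => code (f (iter k remove_min B))).
  move=> i; apply: (borel_preimage (remove_min_borel_map k)
    (B := f @^-1` [set t | code t = i])).
  by apply: bf; exact: discrete_open.
pose G : set incseq := [set B | le (f B) (f (remove_min B))].
have bG : borel G.
  have := borel_nat_rel (fun a b => exists t t', [/\ code t = a, code t' = b & le t t'])
    (bcf 0) (bcf 1).
  congr (borel _); apply/seteqP; split=> B /=; last by exists (f B), (f (remove_min B)).
  case=> t [t' [te te' tt']]; apply: le_trans (code_le te').
  exact: le_trans (code_le (esym te)) tt'.
have [Z [_ uZ [ZG|ZG]]] := galvin_prikry bG [::] uT.
  have [A AZ] := unbounded_incseq uZ; exists A => B BA; apply: ZG; split=> // i _.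
  by apply/AZ/BA; exists i.
(* Going through [h] leaves one value for each code. *)
pose F B : seqspace T := fun k => h (code (f (iter k remove_min B))).
have hE t : code (h (code t)) = code t by exact: hP.
have bF : borel_map F.
  apply: (borel_seq_map (code := code)) => [z z' m m'|m].
    by rewrite /F !hE => ->.
  by move=> i; have := bcf m i; congr borel; apply/seteqP; split=> B /=; rewrite hE.
have F_shift B : F (remove_min B) = shift_seq (F B).
  by apply/funext => k; rewrite /F -iterSr.
have bcF : borel_nat (c \o F) := borel_nat_comp bF bc.
(* On [W] the color of [F] is constant. *)
have : exists W, [/\ W `<=` Z, unbounded W &
    forall i, (i < 3)%N -> decides [set B | c (F B) = i] [::] W].
  elim: 3 => [|n [W [WZ uW dW]]]; first by exists Z; split.
  have [V [VW uV dV]] := galvin_prikry (bcF n) [::] uW.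
  exists V; split=> // [|i]; first exact: subset_trans WZ.
  by rewrite ltnS leq_eqVlt => /orP[/eqP->//|/dW]; exact: decides_sub.
move=> [W [WZ uW dW]]; have [B BW] := unbounded_incseq uW.
have BW_iter k : ellentuck [::] W (iter k remove_min B).
  split=> // i _; apply: BW; elim: k i => [|k IH] i /=; first by exists i.
  exact: IH i.+1.
have Fbad : bad le (F B).
  move=> k lek.
  have : ellentuck [::] Z (iter k remove_min B) by exact: ellentuck_sub (BW_iter k).
  move=> /ZG; apply; rewrite /G /=; apply: le_trans (code_le (hE _)).
  by apply: le_trans lek; apply: code_le; rewrite hE.
case: (dW _ (c3 (F B))) => sub.
  have e : c (F (remove_min B)) = c (F B) := sub _ (BW_iter 1).
  by case: (cS _ Fbad); rewrite -F_shift e.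
by case: (sub _ (BW_iter 0)).
Qed.

End ColoringBqo.

(** * Transfer of a coloring along a map to labels *)

Section FirstChange.
Variables (T : Type) (s : seqspace T -> bool).
Local Notation S := (@shift_seq T).

Definition changes n (X : seqspace T) : bool := s (iter n S X) != s X.

(** A first change occurs after at least one step, so [0] can stand for none. *)
Definition first_change (X : seqspace T) : nat :=
  if pselect (exists n, changes n X) is left e then ex_minn e else 0.

Lemma first_changeP X n : first_change X = n.+1 <->
  changes n.+1 X /\ forall m, (m <= n)%N -> ~~ changes m X.
Proof.
rewrite /first_change; case: pselect => [e|ne]; last first.
  by split=> // -[h]; case: ne; exists n.+1.
case: ex_minnP => m hm m_min; split=> [mn|[hn n_min]].
  rewrite -mn; split=> // k kn; apply/negP => /m_min; rewrite mn.
  by rewrite leqNgt ltnS kn.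
apply/eqP; rewrite eqn_leq m_min //= ltnNge; apply/negP => /n_min.
by rewrite hm.
Qed.

Lemma first_change0 X : first_change X = 0 <-> forall n, ~~ changes n X.
Proof.
rewrite /first_change; case: pselect => [e|ne]; last first.
  by split=> // _ n; apply/negP => h; apply: ne; exists n.
case: ex_minnP => m hm m_min; split=> [m0|/(_ m)]; last by rewrite hm.
by move: hm; rewrite m0 /changes eqxx.
Qed.

Lemma first_change_borel :
  borel [set X : seqspace T | s X] -> borel_nat first_change.
Proof.
move=> bs; have bs' := borel_nat_bool bs.
have bc n : borel [set X : seqspace T | changes n X].
  rewrite /changes.
  have := borel_nat_rel (fun a b => a != b)
    (borel_nat_comp (@iter_shift_borel_map T n) bs') bs'.
  by congr (borel _); apply/seteqP; split=> X /=; case: (s X); case: (s _).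
case=> [|n].
  rewrite (_ : [set X | _] = [set X | forall n, ~ changes n X]); last first.
    by apply/seteqP; split=> X /=; rewrite first_change0 => h n; apply/negP.
  by apply: borel_all => n; apply: borelN.
rewrite (_ : [set X | _] = [set X | changes n.+1 X /\
    forall m, (m <= n)%N -> ~ changes m X]); last first.
  by apply/seteqP; split=> X /=; rewrite first_changeP => -[h h'];
    split=> // m /h' /negP.
apply: borel_and => //; apply: borel_all => m.
by apply: borel_imp; [exact: borel_cst | apply: borelN].
Qed.

Lemma first_change_shift X n : first_change (S X) = n.+1 -> s X = s (S X) ->
  first_change X = n.+2.
Proof.
rewrite !first_changeP /changes => -[h h'] e; split; first by rewrite iterSr e.
by case=> [|m] mn; [rewrite eqxx | rewrite iterSr e; exact: h'].
Qed.

Lemma first_change_shift0 X : first_change X = 0 ->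
  s (S X) = s X /\ first_change (S X) = 0.
Proof.
rewrite !first_change0 => h; have /negPn/eqP e := h 1.
split=> // n; have := h n.+1; rewrite /changes iterSr.
by rewrite -[s (S X)]/(s (iter 1 S X)) e.
Qed.

End FirstChange.

Section Transfer.
Variables (T Q : Type) (le : T -> T -> Prop) (leQ : Q -> Q -> Prop).
Variables (code : Q -> nat) (F : seqspace T -> Q).
Hypothesis code_inj : injective code.
Hypothesis F_borel : borel_nat (code \o F).
Local Notation S := (@shift_seq T).
Hypothesis F_bad : forall X, bad le X ->
  exists k, ~ leQ (F (iter k S X)) (F (iter k.+1 S X)).

(** The first four colors encode the kind of the first step together with the
    parity of the first change; the last three are those of [Q],
    used when no step ascends. *)
Lemma transfer_coloring cQ : coloring leQ 3 cQ -> exists c, coloring le 7 c.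
Proof.
move=> [cQ3 bcQ cQS]; pose s X := `[< ~ leQ (F X) (F (S X)) >].
pose G (X : seqspace T) : seqspace Q := fun k => F (iter k S X).
have bG : borel_map G.
  apply: (borel_seq_map (code := code)) => [z z' m m' /code_inj //|m].
  exact: (borel_nat_comp (@iter_shift_borel_map T m) F_borel).
have bs : borel [set X : seqspace T | s X].
  have := borel_nat_rel (fun a b => forall q q', code q = a -> code q' = b -> ~ leQ q q')
    F_borel (borel_nat_comp (@shift_borel_map T) F_borel).
  congr (borel _); apply/seteqP; split=> X /=; rewrite /s asboolE.
    by move=> h; exact: h.
  by move=> h q q' /code_inj-> /code_inj->.
pose c (X : seqspace T) := if `[< first_change s X = 0 >] then 4 + cQ (G X)
  else (odd (first_change s X)).*2 + s X.
exists c; split=> [X||X bX].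
- rewrite /c; case: asboolP => _; first by rewrite ltn_add2l.
  by case: odd; case: (s X).
- apply: borel_nat_if.
  + exact: first_change_borel.
  + exact: (borel_nat2 (fun _ b => 4 + b) (borel_nat_comp bG bcQ) (borel_nat_comp bG bcQ)).
  + by apply: (borel_nat2 (fun a b => (odd a).*2 + b));
      [exact: first_change_borel | exact: borel_nat_bool].
have [k bk] := F_bad bX.
have G_shift : G (S X) = shift_seq (G X).
  by apply/funext => j; rewrite /G -iterSr.
rewrite /c; case: asboolP => [X0|].
  have [_ SX0] := first_change_shift0 X0; rewrite SX0 asboolT // => /addnI.
  rewrite G_shift; apply: cQS => j; have sk : s (iter k S X) by apply/asboolP.
  move: X0 => /first_change0 h; have /negPn/eqP ek := h k; have /negPn/eqP ej := h j.
  by have : s (iter j S X) by [rewrite ej -ek]; move/asboolP.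
case e1 : (first_change s X) => [|n]; [by move=> /(_ erefl) | move=> _].
case: asboolP => [_|].
  by rewrite oddS; case: odd; case: (s X).
case e2 : (first_change s (S X)) => [|m]; [by move=> /(_ erefl) | move=> _].
have [es|] := eqVneq (s X) (s (S X)); last first.
  by case: odd; case: odd; case: (s X); case: (s (S X)).
have := first_change_shift e2 es; rewrite e1 => -[->].
by rewrite es /=; case: (odd m); case: (s _).
Qed.

End Transfer.

(** * Finite trees *)

Section FiniteTree.
Context {Q : Type} {t : finite_tree Q}.
Implicit Types x y z u v w : node t.

Lemma node_le_refl x : node_le x x.
Proof. by have [[r _ _] _ _] := node_tree t. Qed.

Lemma node_le_anti x y : node_le x y -> node_le y x -> x = y.
Proof. by have [[_ a _] _ _] := node_tree t; exact: a. Qed.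

Lemma node_le_trans y x z : node_le x y -> node_le y z -> node_le x z.
Proof. by have [[_ _ h] _ _] := node_tree t; exact: h. Qed.

Lemma node_le_lt_trans y x z : node_le x y -> node_lt y z -> node_lt x z.
Proof.
move=> xy [yz ne]; split; first exact: node_le_trans yz.
by move=> xz; apply: ne; apply: node_le_anti => //; rewrite -xz.
Qed.

Lemma node_lt_le_trans y x z : node_lt x y -> node_le y z -> node_lt x z.
Proof.
move=> [xy ne] yz; split; first exact: node_le_trans yz.
by move=> xz; apply: ne; apply: node_le_anti => //; rewrite xz.
Qed.

Lemma node_leP x y : node_le x y -> x = y \/ node_lt x y.
Proof. by move=> xy; have [->|ne] := EM (x = y); [left|right]. Qed.

Lemma below_comparable x y z : node_le x z -> node_le y z -> node_le x y \/ node_le y x.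
Proof.
move=> xz yz; have [_ wo _] := node_tree t.
have [||m mxy min] := wo z [set v | v = x \/ v = y].
- by move=> _ [->|->].
- by exists x; left.
by case: mxy => e; [left|right]; rewrite -e; apply: min; [right|left].
Qed.

Lemma root_exists : exists r : node t, forall v, node_le r v.
Proof. by have [] := node_tree t. Qed.

Definition root : node t := projT1 (cid root_exists).

Lemma root_le v : node_le root v.
Proof. by rewrite /root; case: cid => r. Qed.

Lemma first_step_exists x w : exists c, node_lt x w ->
  [/\ node_lt x c, node_le c w & forall v, node_lt x v -> node_le v w -> node_le c v].
Proof.
have [xw|nxw] := EM (node_lt x w); last by exists x.
have [_ wo _] := node_tree t.
have [||c [xc cw] c_min] := wo w [set v | node_lt x v /\ node_le v w].
- by move=> v [].
- by exists w; split=> //; exact: node_le_refl.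
by exists c => _; split=> // v xv vw; apply: c_min.
Qed.

(** The immediate successor of [x] on the way to [w], when [x] is below [w].
    Functions on the nodes above [x] are glued from functions on the subtrees
    at these successors. *)
Definition first_step x w : node t := projT1 (cid (first_step_exists x w)).

Lemma first_stepP x w : node_lt x w ->
  node_lt x (first_step x w) /\ node_le (first_step x w) w.
Proof. by rewrite /first_step; case: cid => c h /h[]. Qed.

Lemma first_step_le x v w : node_lt x v -> node_le v w -> first_step x v = first_step x w.
Proof.
move=> xv vw; have xw := node_lt_le_trans xv vw.
have [xcv cv] := first_stepP xv; have [xcw cw] := first_stepP xw.
have cv_min u : node_lt x u -> node_le u v -> node_le (first_step x v) u.
  by rewrite /first_step; case: cid => c /= /(_ xv)[_ _]; exact.
have cw_min u : node_lt x u -> node_le u w -> node_le (first_step x w) u.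
  by rewrite /first_step; case: cid => c /= /(_ xw)[_ _]; exact.
have wv : node_le (first_step x w) (first_step x v).
  by apply: cw_min => //; exact: node_le_trans vw.
apply: node_le_anti => //.
by apply: cv_min => //; exact: node_le_trans cv.
Qed.

Lemma enum_exists : exists s : seq {classic node t}, forall x : {classic node t}, x \in s.
Proof.
have /finite_seqP[s es] : finite_set [set: {classic node t}] := @node_finite _ t.
by exists s => x; have : [set: {classic node t}] x by []; rewrite es.
Qed.

Definition nodes : seq {classic node t} := undup (projT1 (cid enum_exists)).

Lemma mem_nodes (x : {classic node t}) : x \in nodes.
Proof. by rewrite /nodes mem_undup; case: cid. Qed.

Definition rank (x : node t) : nat := index (x : {classic node t}) nodes.

Lemma rank_inj : injective rank.
Proof.
move=> x y e; pose x' : {classic node t} := x; pose y' : {classic node t} := y.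
have := nth_index x' (mem_nodes x'); rewrite (_ : index x' nodes = index y' nodes) //.
by rewrite nth_index //; exact: mem_nodes.
Qed.

Lemma up_induction (P : node t -> Prop) :
  (forall y, (forall y', node_lt y y' -> P y') -> P y) -> forall y, P y.
Proof.
move=> step y; pose up z := [seq z' <- nodes | `[< node_lt z z' >]].
have [n] := ubnP (size (up y)); elim: n y => // n IH y.
rewrite ltnS => yn; apply: step => y' yy'.
apply: IH; apply: leq_trans yn; rewrite !size_filter.
have : subpred (fun z' => `[< node_lt y' z' >]) (fun z' => `[< node_lt y z' >]).
  by move=> z /asboolP y'z; apply/asboolP; exact: node_le_lt_trans yy'.1 y'z.
have : (y' : {classic node t}) \in nodes by exact: mem_nodes.
elim: nodes => //= z l IHl; rewrite inE => /orP[/eqP<-|zl] sub.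
  rewrite [`[< node_lt y y' >]]asboolT // [`[< node_lt y' y' >]]asboolF; last by case.
  by rewrite add0n add1n ltnS; exact: sub_count.
rewrite -addnS; apply: leq_add; last exact: IHl.
by case: asboolP => // /asboolP/sub ->.
Qed.

(** Compactness of a finite set. *)
Lemma decreasing_inhabited (A : nat -> node t -> Prop) :
  (forall n y, A n.+1 y -> A n y) -> (forall n, exists y, A n y) ->
  exists y, forall n, A n y.
Proof.
move=> A_dec A_ex; apply: contrapT => nA.
have /choice[N NP] : forall y, exists n, ~ A n y.
  by move=> y; apply/existsNP => Ay; apply: nA; exists y.
have [y Ay] := A_ex (\max_(y <- nodes) N y).
apply: (NP y); have : (N y <= \max_(y <- nodes) N y)%N.
  exact: (@leq_bigmax_seq {classic node t} nodes predT N y (mem_nodes _) isT).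
move: Ay; elim: (\max_(_ <- _) _) => [|n IH] Ay; first by rewrite leqn0 => /eqP->.
by rewrite leq_eqVlt => /orP[/eqP->//|]; apply: IH; exact: A_dec.
Qed.

End FiniteTree.

(** * Refuting an embedding of trees *)

Section Strategy.
Variables (Q : Type) (leQ : Q -> Q -> Prop).

(** The subtree at [x] maps to the subtree at [y], with [x] sent to [y]. *)
Definition rooted_le (t s : finite_tree Q) (x : node t) (y : node s) : Prop :=
  exists h : node t -> node s,
    [/\ forall u v, node_le x u -> node_lt u v -> node_lt (h u) (h v),
        forall u, node_le x u -> leQ (label u) (label (h u)) & h x = y].

(** Maps of the subtrees above [x] glue together: two comparable nodes above [x]
    lie in the same of these subtrees. *)
Lemma rooted_le_step (t s : finite_tree Q) (x : node t) (y : node s) :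
  leQ (label x) (label y) ->
  (forall x', node_lt x x' -> exists2 y', node_lt y y' & rooted_le x' y') ->
  rooted_le x y.
Proof.
move=> xy sub.
have /choice[H HP] : forall c, exists h : node t -> node s, node_lt x c ->
    [/\ forall u v, node_le c u -> node_lt u v -> node_lt (h u) (h v),
        forall u, node_le c u -> leQ (label u) (label (h u)) & node_lt y (h c)].
  move=> c; have [xc|nxc] := EM (node_lt x c); last by exists (fun=> y).
  by have [y' yy' [h [h1 h2 h3]]] := sub _ xc; exists h => _; rewrite h3.
pose h w := if pselect (node_lt x w) then H (first_step x w) w else y.
have hE w : node_lt x w -> h w = H (first_step x w) w.
  by rewrite /h; case: pselect.
have hx : h x = y by rewrite /h; case: pselect => // -[].
exists h; split=> // [u v xu uv|u xu].
  have xv := node_le_lt_trans xu uv; rewrite (hE v xv).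
  have [xc cv] := first_stepP xv; have [h1 _ h3] := HP _ xc.
  have [<-|xu'] := node_leP xu.
    rewrite hx; have [e|cv'] := node_leP cv; first by rewrite -[X in H _ X]e.
    exact: node_lt_le_trans h3 (h1 _ _ (node_le_refl _) cv').1.
  rewrite (hE u xu') (first_step_le xu' uv.1); apply: h1 => //.
  by rewrite -(first_step_le xu' uv.1); have [] := first_stepP xu'.
have [<-|xu'] := node_leP xu; first by rewrite hx.
rewrite (hE u xu'); have [xc cu] := first_stepP xu'.
by have [_ h2 _] := HP _ xc; exact: h2.
Qed.

(** A strategy against mapping [t] to [s] in which the opponent climbs in [s] from
    [y]: the refuter stands at [G w] when the opponent stands at [w], and at
    [D w] as soon as the opponent is to leave [w] upwards.  At each node the
    refuter either shows a label that is not dominated, or gains height. *)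
Definition refutes (t s : finite_tree Q) (y : node s) (G D : node s -> node t) :=
  (forall w, node_le y w -> node_le (G w) (D w) /\
     (~ leQ (label (G w)) (label w) \/ node_lt (G w) (D w))) /\
  (forall w w', node_le y w -> node_lt w w' -> node_le (D w) (G w')).

(** At [y], either the labels of [x] and [y] are not in order and [x] can stay, or
    by [rooted_le_step] some [x1] above [x] maps to no node above [y]; in both
    cases the refuter goes on from there in each subtree above [y]. *)
Lemma refutes_exists (t s : finite_tree Q) (y : node s) : forall x : node t,
  (forall y', node_le y y' -> ~ rooted_le x y') ->
  exists G D, refutes y G D /\ G y = x.
Proof.
move: y; apply: up_induction => y IH x Rxy.
have [x1 [xx1 xx1' Rx1]] : exists x1, [/\ node_le x x1,
    ~ leQ (label x) (label y) \/ node_lt x x1 &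
    forall y', node_lt y y' -> ~ rooted_le x1 y'].
  have [xy|nxy] := EM (leQ (label x) (label y)); last first.
    exists x; split; [exact: node_le_refl | by left | by move=> y' [/Rxy]].
  have := Rxy _ (node_le_refl y) \o rooted_le_step xy.
  move=> /existsNP[x1 /not_implyP[xx1 nx1]].
  exists x1; split; [exact: xx1.1 | by right | move=> y' yy' h].
  by apply: nx1; exists y'.
have /choice[GD GDP] : forall c, exists GD : (node s -> node t) * (node s -> node t),
    node_lt y c -> refutes c GD.1 GD.2 /\ GD.1 c = x1.
  move=> c; have [yc|nyc] := EM (node_lt y c); last by exists (fun=> x, fun=> x).
  have [|G [D GDc]] := IH _ yc x1; last by exists (G, D).
  by move=> y' /(node_lt_le_trans yc); exact: Rx1.
pose G w := if pselect (node_lt y w) then (GD (first_step y w)).1 w else x.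
pose D w := if pselect (node_lt y w) then (GD (first_step y w)).2 w else x1.
have GE w : node_lt y w -> G w = (GD (first_step y w)).1 w.
  by rewrite /G; case: pselect.
have DE w : node_lt y w -> D w = (GD (first_step y w)).2 w.
  by rewrite /D; case: pselect.
have Gy : G y = x by rewrite /G; case: pselect => // -[].
have Dy : D y = x1 by rewrite /D; case: pselect => // -[].
exists G, D; split=> //; split=> [w yw|w w' yw ww'].
  have [<-|yw'] := node_leP yw; first by rewrite Gy Dy.
  have [yc cw] := first_stepP yw'; rewrite GE // DE //.
  by have [[h _] _] := GDP _ yc; exact: h.
have yw' := node_le_lt_trans yw ww'.
have [yc cw] := first_stepP yw'; have [[h1 h2] h3] := GDP _ yc; rewrite (GE w' yw').
have [<-|ylw] := node_leP yw.
  rewrite Dy -h3; have [e|cw'] := node_leP cw; first by rewrite {2}e; exact: node_le_refl.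
  apply: node_le_trans (h2 _ _ (node_le_refl _) cw').
  by have [] := h1 _ (node_le_refl (first_step y w')).
rewrite (DE w ylw) (first_step_le ylw ww'.1); apply: h2 => //.
by rewrite -(first_step_le ylw ww'.1); have [] := first_stepP ylw.
Qed.

Lemma strategy_exists (t s : finite_tree Q) :
  exists GD : (node s -> node t) * (node s -> node t),
    ~ tree_le1 leQ t s -> refutes root GD.1 GD.2.
Proof.
have [ts|nts] := EM (tree_le1 leQ t s); first by exists (fun=> root, fun=> root).
have [y' _ [h [h1 h2 _]]|G [D [GD _]]] := @refutes_exists t s root root.
  apply: nts; exists h; split=> [u v|u]; first by apply: h1; exact: root_le.
  by apply: h2; exact: root_le.
by exists (G, D).
Qed.

End Strategy.

(** * The trunk of a bad sequence of trees *)

Section Trunk.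
Variables (Q : Type) (leQ : Q -> Q -> Prop).
Local Notation FT := (finite_tree Q).
Local Notation S := (@shift_seq FT).
Local Notation badT := (bad (@tree_le1 Q leQ)).

Definition strategy (t s : FT) := projT1 (cid (strategy_exists leQ t s)).
Definition answer (X : nat -> FT) : node (X 1) -> node (X 0) := (strategy (X 0) (X 1)).1.
Definition advance (X : nat -> FT) : node (X 1) -> node (X 0) := (strategy (X 0) (X 1)).2.

Lemma strategyP X : badT X -> refutes leQ root (@answer X) (@advance X).
Proof. by move=> bX; rewrite /answer /advance /strategy; case: cid => GD; apply. Qed.

Lemma answer_le_advance X w : badT X -> node_le (@answer X w) (@advance X w).
Proof. by move=> /strategyP[h _]; have [] := h w (root_le w). Qed.

Lemma answer_refutes X w : badT X ->
  ~ leQ (label (@answer X w)) (label w) \/ node_lt (@answer X w) (@advance X w).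
Proof. by move=> /strategyP[h _]; have [] := h w (root_le w). Qed.

Lemma advance_le_answer X w w' : badT X -> node_lt w w' ->
  node_le (@advance X w) (@answer X w').
Proof. by move=> /strategyP[_ h]; apply: h; exact: root_le. Qed.

Lemma answer_mono X w w' : badT X -> node_le w w' ->
  node_le (@answer X w) (@answer X w').
Proof.
move=> bX /node_leP[<-|ww']; first exact: node_le_refl.
by apply: node_le_trans (answer_le_advance w bX) _; exact: advance_le_answer.
Qed.

Definition family := forall X : nat -> FT, node (X 0) -> Prop.

Fixpoint approx (P : family) (n : nat) : family := fun X x =>
  if n is n'.+1 then
    P X x /\ exists y : node (S X 0), approx P n' y /\ node_le x (@answer X y)
  else P X x.

(** The node starts a sequence of nodes in [P], each at most the answer to the next
    one.  Defining this by finite approximations keeps it Borel; by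
    compactness it is the greatest fixed point ([thread_next],
    [thread_coind]). *)
Definition thread (P : family) : family := fun X x => forall n, @approx P n X x.

Lemma approxS P n X x : @approx P n.+1 X x -> @approx P n X x.
Proof.
elim: n X x => [|n IH] X x; first by case.
move=> [Px [y [Ay xy]]]; split=> //; exists y; split=> //; exact: IH.
Qed.

Lemma thread_sub P X x : @thread P X x -> P X x.
Proof. by move/(_ 0). Qed.

Lemma thread_next P X x : @thread P X x ->
  exists y : node (S X 0), thread P y /\ node_le x (@answer X y).
Proof.
move=> tx; have [n y [Ay xy]|n|y yP] :=
  @decreasing_inhabited _ _
    (fun n (y : node (S X 0)) => approx P n y /\ node_le x (@answer X y)).
- by split=> //; exact: approxS.
- by have [] := tx n.+1.
by exists y; split=> [n|]; [have [] := yP n | have [] := yP 0].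
Qed.

Lemma thread_coind (P D : family) :
  (forall X x, D X x -> P X x) ->
  (forall X x, D X x -> exists y : node (S X 0), D (S X) y /\ node_le x (@answer X y)) ->
  forall X x, D X x -> thread P x.
Proof.
move=> DP DS X x Dx n; elim: n X x Dx => [|n IH] X x Dx; first exact: DP.
by split; [exact: DP | have [y [Dy xy]] := DS _ _ Dx; exists y; split=> //; exact: IH].
Qed.

Definition live : family := thread (fun _ _ => True).

(** Live nodes of the same tree can be incomparable, and picking one of them
    arbitrarily would not commute with the shift.  The nodes comparable with all
    live ones form a chain. *)
Definition central : family := fun X x =>
  live x /\ forall e, live e -> node_le e x \/ node_le x e.

Definition trunk : family := thread central.

Lemma live_root X : live (root : node (X 0)).
Proof.
apply: (@thread_coind (fun _ _ => True) (fun X x => x = root)) => // Y _ ->.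
by exists root; split=> //; exact: root_le.
Qed.

Lemma trunk_root X : trunk (root : node (X 0)).
Proof.
apply: (@thread_coind central (fun X x => x = root)) => // Y _ ->.
  by split; [exact: live_root | move=> e _; right; exact: root_le].
by exists root; split=> //; exact: root_le.
Qed.

Lemma tip_exists X : exists x : node (X 0), trunk x /\ forall y, trunk y -> node_le y x.
Proof.
suff : forall x : node (X 0), trunk x ->
    exists x' : node (X 0), trunk x' /\ forall y, trunk y -> node_le y x'.
  by apply; exact: trunk_root.
apply: up_induction => x IH tx.
have [mx|/existsNP[y /not_implyP[ty nyx]]] := EM (forall y, trunk y -> node_le y x).
  by exists x.
apply: (IH y) => //; split; last by move=> e; apply: nyx; rewrite e; exact: node_le_refl.
have [_ cx] := thread_sub tx; have [ly _] := thread_sub ty.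
by case: (cx _ ly).
Qed.

Definition tip X : node (X 0) := projT1 (cid (tip_exists X)).

Lemma tip_trunk X : trunk (tip X).
Proof. by rewrite /tip; case: cid => x [tx h]. Qed.

Lemma le_tip X (y : node (X 0)) : trunk y -> node_le y (tip X).
Proof. by move=> ty; rewrite /tip; case: cid => x [tx h]; exact: h. Qed.

Definition tip_label (X : nat -> FT) : Q := label (tip X).

(** The situation to be refuted: the labels of the tips ascend at each step. *)
Let settled X := badT X /\
  forall k, leQ (tip_label (iter k S X)) (tip_label (iter k.+1 S X)).

Let settledS X : settled X -> settled (S X).
Proof.
move=> [bX h]; split; first exact: bad_shift.
by move=> k; have := h k.+1; rewrite !iterSr.
Qed.

Let next X : node (X 0) := @advance X (tip (S X)).

(** The tip is at most the answer to the next tip; if equal to it, then the order of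
    the labels forces a gain in height. *)
Let tip_lt_next X : settled X -> node_lt (tip X) (next X).
Proof.
move=> [bX h]; have [y [ty xy]] := thread_next (tip_trunk X).
have : node_le (tip X) (@answer X (tip (S X))).
  by apply: node_le_trans xy _; apply: answer_mono => //; exact: le_tip.
have adv := @answer_le_advance X (tip (S X)) bX.
move=> /node_leP[e|lt]; last exact: node_lt_le_trans lt adv.
by have [] := @answer_refutes X (tip (S X)) bX; rewrite /next -e //; have := h 0.
Qed.

Let next_le_next X : settled X -> node_le (next X) (@answer X (next (S X))).
Proof.
by move=> sX; apply: advance_le_answer; [exact: sX.1 | exact/tip_lt_next/settledS].
Qed.

Let next_live X : settled X -> live (next X).
Proof.
move=> sX.
apply: (@thread_coind (fun _ _ => True) (fun X x => settled X /\ x = next X)) => //.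
move=> Y _ [sY ->]; exists (next (S Y)); split; last exact: next_le_next.
by split=> //; exact: settledS.
Qed.

(** A live node [e] is at most the answer to a live node [f] of the next tree, which
    is comparable with the tip there.  If [f] is below that tip, then [e] is
    below [next X]; if it is above, then [e] and [next X] are both below the
    answer to [f]. *)
Let next_central X : settled X -> central (next X).
Proof.
move=> sX; split=> [|e le]; first exact: next_live.
have [f [lf ef]] := thread_next le.
have [_ /(_ _ lf) fc] := thread_sub (tip_trunk (S X)).
have [ft|tf] : node_le f (tip (S X)) \/ node_lt (tip (S X)) f.
  case: fc; first by left.
  by move=> /node_leP[<-|tf]; [left; exact: node_le_refl | right].
  left; apply: node_le_trans ef _.
  by apply: node_le_trans (answer_le_advance _ sX.1); exact: answer_mono sX.1 ft.
by apply: below_comparable ef _; exact: advance_le_answer sX.1 tf.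
Qed.

Theorem tip_label_bad X : badT X ->
  exists k, ~ leQ (tip_label (iter k S X)) (tip_label (iter k.+1 S X)).
Proof.
move=> bX; apply/existsNP => h; have sX : settled X by split.
have [le ne] := tip_lt_next sX; apply: ne; apply: node_le_anti => //; apply: le_tip.
apply: (@thread_coind central (fun X x => settled X /\ x = next X)) => //.
  by move=> Y _ [sY ->]; exact: next_central.
move=> Y _ [sY ->]; exists (next (S Y)); split; last exact: next_le_next.
by split=> //; exact: settledS.
Qed.

End Trunk.

(** * The label of the tip is a Borel function *)

Section BorelFamily.
Variables (Q : Type) (leQ : Q -> Q -> Prop).
Local Notation FT := (finite_tree Q).
Local Notation S := (@shift_seq FT).

(** The nodes depend on the sequence; replacing them by their rank turns
    quantification over nodes into quantification over natural numbers. *)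
Definition borel_family (P : family Q) : Prop :=
  forall i, borel [set X : seqspace FT | exists2 x : node (X 0), rank x = i & P X x].

Lemma local_borel (P : FT -> FT -> Prop) : borel [set X : seqspace FT | P (X 0) (X 1)].
Proof. by apply: (@prefix_borel _ 2) => X Y XY; rewrite (XY 0) // (XY 1). Qed.

Lemma borel_approx P n : borel_family P -> borel_family (approx leQ P n).
Proof.
move=> bP; elim: n => [|n IH] i; first exact: bP.
rewrite (_ : [set X | _] = [set X : seqspace FT |
    (exists2 x : node (X 0), rank x = i & P X x) /\ exists j,
    (exists x : node (X 0), exists y : node (X 1),
      [/\ rank x = i, rank y = j & node_le x ((strategy leQ (X 0) (X 1)).1 y)]) /\
    exists2 y : node (S X 0), rank y = j & approx leQ P n y]); last first.
  apply/seteqP; split=> X /=.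
    move=> [x xi [Px [y [Ay xy]]]]; split; first by exists x.
    by exists (rank y); split; [exists x, y | exists y].
  move=> [[x xi Px] [j [[x' [y [x'i yj x'y]]] [y' y'j Ay']]]].
  have ex : x' = x by apply: rank_inj; rewrite x'i.
  have ey : y = y' by apply: rank_inj; rewrite yj.
  by exists x => //; split=> //; exists y'; split=> //; rewrite -ex -ey.
apply: borel_and; first exact: bP.
apply: borel_ex => j; apply: borel_and.
  exact: (local_borel (fun t s => exists x : node t, exists y : node s,
    [/\ rank x = i, rank y = j & node_le x ((strategy leQ t s).1 y)])).
exact: (borel_preimage (@shift_borel_map FT) (IH j)).
Qed.

Lemma borel_thread P : borel_family P -> borel_family (thread leQ P).
Proof.
move=> bP i; rewrite (_ : [set X | _] = [set X : seqspace FT | forall n,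
    exists2 x : node (X 0), rank x = i & approx leQ P n x]); last first.
  apply/seteqP; split=> X /=; first by move=> [x xi tx] n; exists x.
  move=> h; have [x xi _] := h 0; exists x => // n; have [y yi Ay] := h n.
  by rewrite (_ : x = y) //; apply: rank_inj; rewrite yi.
by apply: borel_all => n; exact: borel_approx.
Qed.

(** Both central nodes and the tip are of this form. *)
Lemma borel_against (P P' : family Q) (rel : forall t : FT, node t -> node t -> Prop) :
  borel_family P -> borel_family P' ->
  borel_family (fun X x => P X x /\ forall y, P' X y -> rel (X 0) x y).
Proof.
move=> bP bP' i; rewrite (_ : [set X | _] = [set X : seqspace FT |
    (exists2 x : node (X 0), rank x = i & P X x) /\ forall j,
    (exists2 y : node (X 0), rank y = j & P' X y) ->
    exists x : node (X 0), exists y : node (X 0),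
      [/\ rank x = i, rank y = j & rel (X 0) x y]]); last first.
  apply/seteqP; split=> X /=.
    move=> [x xi [Px xP']]; split; first by exists x.
    by move=> j [y yj P'y]; exists x, y; split=> //; exact: xP'.
  move=> [[x xi Px] h]; exists x => //; split=> // y P'y.
  have [|x' [y' [x'i y'j]]] := h (rank y); first by exists y.
  by rewrite (rank_inj y'j) (rank_inj (etrans x'i (esym xi))).
apply: borel_and; first exact: bP.
apply: borel_all => j; apply: borel_imp; first exact: bP'.
exact: (local_borel (fun t _ => exists x : node t, exists y : node t,
  [/\ rank x = i, rank y = j & rel t x y])).
Qed.

Lemma borel_tip_label (code : Q -> nat) :
  borel_nat (code \o (tip_label leQ : seqspace FT -> Q)).
Proof.
have b_all : borel_family (fun _ _ => True).
  by move=> i; exact: (local_borel (fun t _ => exists2 x : node t, rank x = i & True)).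
have b_live : borel_family (live leQ) by exact: borel_thread.
have b_central : borel_family (central leQ).
  exact: (@borel_against _ _ (fun t x e => node_le e x \/ node_le x e)).
have b_trunk : borel_family (trunk leQ) by exact: borel_thread.
have b_tip := borel_against (fun t x y => node_le y x) b_trunk b_trunk.
move=> q; rewrite (_ : [set X | _] = [set X : seqspace FT | exists i,
  (exists2 x : node (X 0), rank x = i &
    trunk leQ x /\ forall y, trunk leQ y -> node_le y x) /\
  (exists2 x : node (X 0), rank x = i & code (label x) = q)]); last first.
  apply/seteqP; split=> X /=.
    move=> e; exists (rank (tip leQ X)); split; exists (tip leQ X) => //.
    by split; [exact: tip_trunk | move=> y; exact: le_tip].
  move=> [i [[x xi [tx x_max]] [y yi <-]]].
  rewrite /tip_label (_ : tip leQ X = y) //; apply: node_le_anti.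
    by rewrite (rank_inj (etrans yi (esym xi))); apply: x_max; exact: tip_trunk.
  by rewrite (rank_inj (etrans yi (esym xi))); exact: le_tip.
apply: borel_ex => i; apply: borel_and; first exact: b_tip.
exact: (local_borel (fun t _ => exists2 x : node t, rank x = i & code (label x) = q)).
Qed.

End BorelFamily.

(** * The quasi-order of finite labeled trees *)

Section TreeCode.
Variables (Q : Type) (leQ : Q -> Q -> Prop) (code : Q -> nat).
Hypothesis leQ_refl : forall q, leQ q q.
Hypothesis code_inj : injective code.

Lemma tree_le1_refl (t : finite_tree Q) : tree_le1 leQ t t.
Proof. by exists id. Qed.

Lemma tree_le1_trans (leQ_trans : forall q p r, leQ p q -> leQ q r -> leQ p r)
  (s t u : finite_tree Q) : tree_le1 leQ t s -> tree_le1 leQ s u -> tree_le1 leQ t u.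
Proof.
move=> [f [f_lt f_le]] [g [g_lt g_le]]; exists (g \o f); split=> [x y /f_lt/g_lt//|x].
exact: leQ_trans (f_le x) (g_le (f x)).
Qed.

(** A code of the isomorphism type: the labels and the order relation, along the
    enumeration of the nodes. *)
Definition tree_code (t : finite_tree Q) : nat :=
  pickle ([seq code (label x) | x : node t <- nodes],
    [seq [seq `[< node_le x y >] | y : node t <- nodes] | x : node t <- nodes]).

Lemma tree_code_le (t s : finite_tree Q) : tree_code t = tree_code s -> tree_le1 leQ t s.
Proof.
move=> /(pcan_inj (@pickleK _))[labels orders].
have sz : size (@nodes _ t) = size (@nodes _ s).
  by have := congr1 size labels; rewrite !size_map.
pose f (x : node t) : node s := nth (root : {classic node s}) nodes (rank x).
have rank_lt (x : node t) : (rank x < size (@nodes _ t))%N by rewrite index_mem mem_nodes.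
have nthr (x : node t) : nth (root : {classic node t}) nodes (rank x) = x.
  by rewrite nth_index // mem_nodes.
have f_le (x y : node t) : node_le x y <-> node_le (f x) (f y).
  have := congr1 (fun m => nth false (nth [::] m (rank x)) (rank y)) orders.
  rewrite (nth_map (root : {classic node t})) // (nth_map (root : {classic node t})) //.
  rewrite (nth_map (root : {classic node s})) -?sz // (nth_map (root : {classic node s})) -?sz //.
  by rewrite !nthr => e; split=> /asboolP h; apply/asboolP; move: h; rewrite e.
exists f; split=> [x y [xy ne]|x].
  split; first exact/f_le.
  move=> fxy; apply: ne; apply: node_le_anti => //; apply/f_le; rewrite fxy.
  exact: node_le_refl.
have := congr1 (fun m => nth 0 m (rank x)) labels.
rewrite (nth_map (root : {classic node t})) // (nth_map (root : {classic node s})) -?sz //.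
by rewrite nthr => /code_inj ->.
Qed.

End TreeCode.

Unset Implicit Arguments.

Theorem theorem3p7 (R : realType) (Q : Type) (leQ : Q -> Q -> Prop)
    (Q_countable : countable [set: Q]) (Q_bqo : bqo leQ)
    (Q_thin : countable_thin R leQ) :
  thin R (@tree_le1 Q leQ).
Proof.
have [[leQ_refl leQ_trans] _] := Q_bqo.
have /countable_injP[code code_inj'] := Q_countable.
have code_inj : injective code by move=> p q; apply: code_inj'; rewrite inE.
have [cQ cQP] := thin_coloring leQ_refl Q_thin.
have [c7 c7P] := transfer_coloring code_inj (borel_tip_label leQ code)
  (@tip_label_bad _ leQ) cQP.
have [c cP] := coloring_three c7P.
have le1_trans := @tree_le1_trans _ _ leQ_trans.
split; last by move=> A _; exact: coloring_thin cP.
split; first by split; [exact: tree_le1_refl | exact: le1_trans].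
exact: (coloring_bqo le1_trans (@tree_code_le _ _ _ leQ_refl code_inj) cP).
Qed.
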